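(* Let $\mathcal{H}$ be a real Hilbert space, let $m\ge 1$, and let $T_i:\mathcal{H}\to\mathcal{H}$, $i=1,\dots,m$, be firmly nonexpansive operators with $\bigcap_{i=1}^m \mathrm{Fix}\,T_i\neq\emptyset$. Let $F:\mathcal{H}\to\mathcal{H}$ be $\eta$-strongly monotone and $\kappa$-Lipschitz continuous with $\kappa\ge\eta>0$. Suppose that $\mu\in(0,2\eta/\kappa^2)$, that $\{\beta_n\}_{n=1}^\infty\subset(0,1]$ satisfies $\lim_{n\to\infty}\beta_n=0$ and $\sum_{n=1}^\infty\beta_n=+\infty$, and that $\{\lambda_n\}_{n=1}^\infty\subset[\varepsilon,1-\varepsilon]$ for some constant $\varepsilon\in(0,1/2]$. Let $e_i^n\in\mathcal{H}$ ($i=1,\dots,m$, $n\ge1$) satisfy $\sum_{n=1}^\infty\|e_i^n\|<+\infty$ for each $i=1,\dots,m$. Let $x^1\in\mathcal{H}$ be arbitrary, and let $\{x^n\}_{n=1}^\infty$ be the sequence generated, for $n\ge1$, by $$\varphi_0^n:=x^n-\mu\beta_nF(x^n),\qquad \varphi_i^n:=T_i\varphi_{i-1}^n+e_i^n\quad(i=1,\dots,m),\qquad x^{n+1}:=(1-\lambda_n)\varphi_0^n+\lambda_n\varphi_m^n.$$ Then $\{x^n\}_{n=1}^\infty$ converges strongly (in norm) to the unique solution of the variational inequality problem: find $x^*\in\bigcap_{i=1}^m\mathrm{Fix}\,T_i$ such that $$\langle F(x^* ),x-x^*\rangle\ge0\quad\text{for all }x\in\bigcap_{i=1}^m\mathr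m{Fix}\,T_i.$$
   Context: For an operator $T:\mathcal{H}\to\mathcal{H}$, $\mathrm{Fix}\,T:=\{x\in\mathcal{H}: Tx=x\}$. $T$ is firmly nonexpansive if $\langle Tx-Ty,x-y\rangle\ge\|Tx-Ty\|^2$ for all $x,y\in\mathcal{H}$. $F$ is $\kappa$-Lipschitz continuous if $\|F(x)-F(y)\|\le\kappa\|x-y\|$ for all $x,y\in\mathcal{H}$, and $\eta$-strongly monotone if $\langle F(x)-F(y),x-y\rangle\ge\eta\|x-y\|^2$ for all $x,y\in\mathcal{H}$. It is known that, under the stated assumptions on $T_i$ and $F$, the variational inequality problem has a unique solution. *)

(* Defs.v *)
From HB Require Import structures.
From mathcomp Require Import all_boot all_order all_algebra.
From mathcomp Require Import all_classical all_reals all_analysis.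

Set Implicit Arguments.
Unset Strict Implicit.
Unset Printing Implicit Defensive.

Import Order.TTheory GRing.Theory Num.Theory.
Import numFieldNormedType.Exports.

Local Open Scope classical_set_scope.
Local Open Scope ring_scope.

(* A real Hilbert space is a complete normed module H over a realType R together
   with a real inner product dot : {dot H for idfun} satisfying norm_of_dot. *)
Definition norm_of_dot (R : realType) (H : completeNormedModType R)
    (dot : {dot H for idfun}) : Prop :=
  forall x : H, `|x| = Num.sqrt (dot x x).

Definition Fix (X : Type) (T : X -> X) : set X := [set x | T x = x].

Definition firmly_nonexpansive (R : realType) (H : completeNormedModType R)
    (dot : {dot H for idfun}) (T : H -> H) : Prop :=
  forall x y : H, `|T x - T y| ^+ 2 <= dot (T x - T y) (x - y).

Definition strongly_monotone (R : realType) (H : completeNormedModType R)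
    (dot : {dot H for idfun}) (eta : R) (F : H -> H) : Prop :=
  forall x y : H, eta * `|x - y| ^+ 2 <= dot (F x - F y) (x - y).

Definition vi_solution (R : realType) (H : completeNormedModType R)
    (dot : {dot H for idfun}) (F : H -> H) (C : set H) : set H :=
  [set xs | C xs /\ forall x, C x -> 0 <= dot (F xs) (x - xs)].

(* Main.v *)
(* Write W for the composition T_m ... T_1, whose fixed points are the common
   fixed points of the T_i, and p for the solution. Each step is a descent step
   y_n := x_n - mu beta_n F(x_n), contracting distances to p up to a drift along
   F(p), followed by a relaxation of W with a summable error; with
   G_n := |x_n - p|^2 + (multiple of the tail of the errors) one gets
     G_{n+1} <= (1 - tau beta_n) G_n + tau beta_n d_n - eps^2 |W y_n - y_n|^2,
   where d_n is, up to a null sequence, a positive multiple of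
   - <F(p), y_n - p>. Approximate fixed points y of W in a ball satisfy
   <F(p), y - p> >= - (small), so either |W y_n - y_n| is bounded below and the
   last term wins, or d_n is small; in both cases sum beta_n = oo forces
   G_n -> 0. *)

Require Import Defs.
From HB Require Import structures.
From mathcomp Require Import all_boot all_order all_algebra.
From mathcomp Require Import all_classical all_reals all_analysis.
From mathcomp Require Import ring lra.

Set Implicit Arguments.
Unset Strict Implicit.
Unset Printing Implicit Defensive.

Import Order.TTheory GRing.Theory Num.Theory.
Import numFieldNormedType.Exports.

Local Open Scope classical_set_scope.
Local Open Scope ring_scope.

(** * Inner product calculus and minimizing sequences *)

Section InnerProduct.
Context (R : realType) (H : completeNormedModType R) (dot : {dot H for idfun}).
Implicit Types (u v w : H) (a : R).

Lemma dotC u v : dot u v = dot v u.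
Proof. by rewrite hermC expr0 mul1r. Qed.

Lemma dotDl u v w : dot (u + v) w = dot u w + dot v w.
Proof. exact: linearDl. Qed.

Lemma dotDr u v w : dot w (u + v) = dot w u + dot w v.
Proof. exact: linearDr. Qed.

Lemma dotNl u w : dot (- u) w = - dot u w.
Proof. exact: linearNl. Qed.

Lemma dotNr u w : dot w (- u) = - dot w u.
Proof. exact: linearNr. Qed.

Lemma dotZl a u w : dot (a *: u) w = a * dot u w.
Proof. by rewrite linearZl_LR. Qed.

Lemma dotZr a u w : dot w (a *: u) = a * dot w u.
Proof. by rewrite dotC dotZl dotC. Qed.

Definition dotE := (dotDl, dotDr, dotNl, dotNr, dotZl, dotZr).

Lemma dot_ge0 u : 0 <= dot u u.
Proof.
have [->|u0] := eqVneq u 0; first by rewrite linear0l.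
exact/ltW/neq0_dnorm_gt0.
Qed.

(* Through [dot_inj], vector identities become ring identities in [R]. *)
Lemma dot_inj u v : (forall w, dot u w = dot v w) -> u = v.
Proof.
move=> uv; apply/eqP; rewrite -subr_eq0; apply/negPn/negP => /(neq0_dnorm_gt0 (s := dot)).
by rewrite dotDl dotNl uv subrr ltxx.
Qed.

Hypothesis hdot : norm_of_dot dot.

Lemma dotxx u : dot u u = `|u| ^+ 2.
Proof. by rewrite hdot sqr_sqrtr// dot_ge0. Qed.

(** Cauchy-Schwarz: expand the square of [|v| u - |u| v] and divide by [|u| |v|]. *)
Lemma dot_le_norm u v : dot u v <= `|u| * `|v|.
Proof.
have [->|u0] := eqVneq u 0; first by rewrite linear0l normr0 mul0r.
have [->|v0] := eqVneq v 0; first by rewrite linear0r normr0 mulr0.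
have pu : 0 < `|u| by rewrite normr_gt0.
have pv : 0 < `|v| by rewrite normr_gt0.
have := dot_ge0 (`|v| *: u - `|u| *: v).
rewrite !dotE !dotxx (dotC v u).
have puv : 0 < `|u| * `|v| by rewrite mulr_gt0.
move=> h; rewrite -subr_ge0 -(pmulr_rge0 _ puv).
by nra.
Qed.

Lemma sqnormD u v : `|u + v| ^+ 2 = `|u| ^+ 2 + 2 * dot u v + `|v| ^+ 2.
Proof. by rewrite -!dotxx !dotE (dotC v u); ring. Qed.

Lemma sqnormB u v : `|u - v| ^+ 2 = `|u| ^+ 2 - 2 * dot u v + `|v| ^+ 2.
Proof. by rewrite sqnormD dotNr normrN mulrN. Qed.

Lemma sqnorm_conv a u v :
  `|(1 - a) *: u + a *: v| ^+ 2 =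
  (1 - a) * `|u| ^+ 2 + a * `|v| ^+ 2 - a * (1 - a) * `|v - u| ^+ 2.
Proof. by rewrite -!dotxx !dotE (dotC v u); ring. Qed.

(** The parallelogram law for [u - w] and [v - w]. *)
Lemma sqnorm_mid u v w :
  4 * `|2^-1 *: (u + v) - w| ^+ 2 =
  2 * `|u - w| ^+ 2 + 2 * `|v - w| ^+ 2 - `|u - v| ^+ 2.
Proof. by rewrite -!dotxx !dotE (dotC v u) (dotC w u) (dotC w v); field. Qed.

Lemma sqnormD_le u v : `|u + v| ^+ 2 <= `|u| ^+ 2 + 2 * dot v (u + v).
Proof. by rewrite sqnormD dotDr (dotC v u) dotxx; have := sqr_ge0 `|v|; lra. Qed.

(* Minimizing sequences over sets that are midpoint convex up to a shift of
   index are Cauchy by the parallelogram law; this replaces weak compactness. *)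
Lemma nested_nearest (K : nat -> set H) (p : H) (M : R) :
  (forall n, exists2 u, K n u & `|u - p| <= M) ->
  (forall n k, (n <= k)%N -> K k `<=` K n) ->
  (forall n, exists k, forall u v, K k u -> K k v -> K n (2^-1 *: (u + v))) ->
  exists2 y, (exists2 y_ : nat -> H, forall n, K n (y_ n) & y_ @ \oo --> y) &
    forall z, (forall n, K n z) -> `|y - p| <= `|z - p|.
Proof.
move=> K0 Kni Kmid.
(* The supremum [d] of [D] is the limit of the distances from [p] to the sets [K n], which increase
   with [n]. *)
pose D := [set r : R | 0 <= r /\ exists n, forall u, K n u -> r <= `|u - p|].
have D0 : D 0 by split => //; exists 0%N.
have Dub : ubound D M.
  move=> r [_ [n rK]]; have [u Ku] := K0 n.
  exact/le_trans/rK.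
have supD : has_sup D by split; [exists 0 | exists M].
set d := sup D.
have d0 : 0 <= d by apply: ub_le_sup => //; exists M.
have d_lb eta : 0 < eta -> exists n, forall u, K n u -> d - eta <= `|u - p|.
  move=> eta0; have [r [_ [n rK]] dr] := sup_adherent eta0 supD.
  by exists n => u Ku; apply: (le_trans (ltW dr)); exact: rK.
have d_ub n eta : 0 < eta -> exists2 u, K n u & `|u - p| <= d + eta.
  move=> eta0; apply: contrapT => noK.
  suff : D (d + eta) by move=> /(ub_le_sup (ex_intro _ M Dub)); rewrite -/d; lra.
  split; first by lra.
  exists n => u Ku; rewrite leNgt; apply/negP => up; apply: noK.
  by exists u => //; exact: ltW.
have [y_ y_P] : {y_ : nat -> H & forall n, K n (y_ n) /\ `|y_ n - p| <= d + n.+1%:R^-1}.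
  apply: (@choice _ _ (fun n u => K n u /\ `|u - p| <= d + n.+1%:R^-1)) => n.
  have n0 : 0 < n.+1%:R^-1 :> R by rewrite invr_gt0.
  by have [u] := d_ub n _ n0; exists u.
have small eta : 0 < eta -> exists N, forall n, (N <= n)%N -> `|y_ n - p| <= d + eta.
  move=> eta0; have [N _ NP] := near_infty_natSinv_lt (PosNum eta0).
  exists N => n Nn; apply: (le_trans (y_P n).2); rewrite lerD2l ltW//.
  exact: NP.
have : cvg (y_ @ \oo).
  apply/cauchy_cvgP/cauchy_exP => eps eps0.
  (* With two points at distance at most [d + eta] from [p] and a midpoint at distance at least
     [d - eta], the parallelogram law bounds their squared distance by [16 d eta + 4 eta^2]. This
     choice makes it at most [eps^2 / 2]. *)
  pose eta := Num.min 1 (eps ^+ 2 / (2 * (16 * d + 4))).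
  have den0 : 0 < 2 * (16 * d + 4) by lra.
  have eta0 : 0 < eta by rewrite lt_min ltr01 divr_gt0// exprn_gt0.
  have eta1 : eta <= 1 by rewrite ge_min lexx.
  have eta2 : eta * (2 * (16 * d + 4)) <= eps ^+ 2.
    by rewrite -ler_pdivlMr// ge_min lexx orbT.
  have [n0 n0P] := d_lb _ eta0.
  have [k kP] := Kmid n0.
  have [N NP] := small _ eta0.
  exists (y_ (maxn k N)); exists (maxn k N) => // n /= kNn.
  rewrite -ball_normE /ball_/=.
  have Ki i : (maxn k N <= i)%N -> K k (y_ i) /\ `|y_ i - p| <= d + eta.
    rewrite geq_max => /andP[ki Ni]; split; last exact: NP.
    by apply: (Kni _ i) => //; exact: (y_P i).1.
  have [Ka ad] := Ki _ (leqnn _); have [Kb bd] := Ki _ kNn.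
  have md := n0P _ (kP _ _ Ka Kb).
  have := sqnorm_mid (y_ (maxn k N)) (y_ n) p.
  move: ad bd md (normr_ge0 (y_ (maxn k N) - p)) (normr_ge0 (y_ n - p)).
  have := normr_ge0 (2^-1 *: (y_ (maxn k N) + y_ n) - p).
  set r := `|2^-1 *: _ - p|; set a := `|y_ (maxn _ _) - p|.
  set b := `|y_ n - p|; set c := `|_ - _|.
  move=> r0 ad bd md a0 b0 par.
  have a2 : a ^+ 2 <= (d + eta) ^+ 2 by rewrite ler_sqr ?nnegrE//; lra.
  have b2 : b ^+ 2 <= (d + eta) ^+ 2 by rewrite ler_sqr ?nnegrE//; lra.
  have r2 : d ^+ 2 - 2 * eta * d <= r ^+ 2.
    by have [dr|rd] := leP d r; nra.
  rewrite -ltr_sqr ?nnegrE ?normr_ge0 ?(ltW eps0)//.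
  have e2 : 0 < eps ^+ 2 by rewrite exprn_gt0.
  by nra.
move=> /cvg_ex[y y_y]; exists y; first by exists y_ => // n; exact: (y_P n).1.
move=> z Kz; apply/ler_addgt0Pr => eps eps0.
have eps30 : 0 < eps / 3 by lra.
have [n0 n0P] := d_lb _ eps30.
have [N NP] := small _ eps30.
move/cvgrPdist_lt : y_y => /(_ _ eps30)[N' _ N'P].
have h1 := n0P _ (Kz n0).
have h2 := NP _ (leq_maxl N N').
have h3 := N'P _ (leq_maxr N N').
have := ler_distD (y_ (maxn N N')) y p.
by rewrite /= in h3; lra.
Qed.

End InnerProduct.

(** * Real series and a recursive inequality *)

Section RealSequences.
Context (R : realType).
Implicit Types (u b d s G : nat -> R).

Lemma sum_nat_ge0 u m n : (forall k, (m <= k)%N -> 0 <= u k) ->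
  0 <= \sum_(m <= k < n) u k.
Proof.
move=> u0; rewrite big_nat_cond sumr_ge0// => k /andP[/andP[mk _] _].
exact: u0.
Qed.

Lemma nondecreasing_sum_nat u m : (forall k, (m <= k)%N -> 0 <= u k) ->
  {homo (fun n => \sum_(m <= k < n) u k) : n k / (n <= k)%N >-> n <= k}.
Proof.
move=> u0 n k nk; have [nm|mn] := leqP n m.
  by rewrite (big_geq nm) sum_nat_ge0.
rewrite [leRHS](big_cat_nat _ nk)/= ?(ltnW mn)// lerDl sum_nat_ge0// => i ni.
by apply: u0; exact: leq_trans (ltnW mn) ni.
Qed.

Lemma nneseries_unbounded u : (forall n, (1 <= n)%N -> 0 <= u n) ->
  (\sum_(1 <= n <oo) (u n)%:E = +oo)%E ->
  forall A, exists N, A <= \sum_(1 <= k < N) u k.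
Proof.
move=> u0 uoo A; apply: contrapT => noN.
have : (\sum_(1 <= n <oo) (u n)%:E <= A%:E)%E.
  apply: lime_le; first by apply: is_cvg_nneseries => n n1 _; rewrite lee_fin u0.
  apply: nearW => N; rewrite sumEFin lee_fin leNgt; apply/negP => /ltW AN.
  by apply: noN; exists N.
by rewrite uoo leye_eq.
Qed.

Lemma nneseries_bounded u : (forall n, (1 <= n)%N -> 0 <= u n) ->
  (\sum_(1 <= n <oo) (u n)%:E < +oo)%E ->
  exists B, forall N, \sum_(1 <= k < N) u k <= B.
Proof.
move=> u0 uoo.
have s0 : (0 <= \sum_(1 <= n <oo) (u n)%:E)%E.
  by apply: nneseries_ge0 => n n1 _; rewrite lee_fin u0.
exists (fine (\sum_(1 <= n <oo) (u n)%:E)%E) => N.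
rewrite -lee_fin fineK ?ge0_fin_numE// -sumEFin.
by apply: nneseries_lim_ge => n n1 _; rewrite lee_fin u0.
Qed.

(* Where [s n] is not small it outweighs [b n * d n], since [b n] tends to 0;
   where it is small, [d n] is. Either way [G n - eps] contracts by [1 - b n]. *)
Lemma recursive_inequality_small G b d s (D : R) :
  (forall n, (1 <= n)%N -> 0 < b n <= 1) -> b @ \oo --> (0 : R) ->
  (forall A, exists N, A <= \sum_(1 <= k < N) b k) ->
  (forall n, (1 <= n)%N -> 0 <= s n) -> (forall n, (1 <= n)%N -> d n <= D) ->
  (forall n, (1 <= n)%N -> G n.+1 <= (1 - b n) * G n + b n * d n - s n) ->
  (forall eps, 0 < eps -> exists2 sg, 0 < sg &
    exists N, forall n, (N <= n)%N -> s n < sg -> d n <= eps) ->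
  forall eps, 0 < eps -> exists N, forall n, (N <= n)%N -> G n <= eps.
Proof.
move=> b01 b0 bS s0 dD hG hd eps eps0.
have b_ge0 n : (1 <= n)%N -> 0 <= b n by move=> /b01 /andP[/ltW].
pose e := eps / 2; have e0 : 0 < e by rewrite divr_gt0.
have [sg sg0 [N1 N1P]] := hd _ e0.
have D0 : 0 < `|D| + 1 by have := normr_ge0 D; lra.
(* Once [b n] is below this quotient, [b n * d n < sg], so a value [s n >= sg] absorbs the whole
   drift. *)
have q0 : 0 < sg / (`|D| + 1) by rewrite divr_gt0.
move/cvgrPdist_lt : b0 => /(_ _ q0)[N2 _ N2P].
pose N0 := maxn 1 (maxn N1 N2).
have N01 : (1 <= N0)%N by rewrite leq_maxl.
have step n : (N0 <= n)%N -> G n.+1 - e <= (1 - b n) * (G n - e).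
  rewrite !geq_max => /andP[n1 /andP[nN1 /N2P/=]].
  rewrite sub0r normrN; have /andP[bn0 bn1] := b01 _ n1.
  rewrite gtr0_norm// ltr_pdivlMr// => bsg.
  have := hG _ n1; have := dD _ n1; have := s0 _ n1.
  have [sn|/(N1P _ nN1) de] := leP sg (s n).
    have := ler_norm D; move: (`|D|) bsg => D'; nra.
  by nra.
pose g n := Num.max (G n - e) 0.
have g0 n : 0 <= g n by rewrite le_max lexx orbT.
have gstep n : (N0 <= n)%N -> g n.+1 <= (1 - b n) * g n.
  move=> Nn; have /andP[bn0 bn1] := b01 _ (leq_trans N01 Nn).
  have b1 : 0 <= 1 - b n by rewrite subr_ge0.
  rewrite ge_max mulr_ge0// andbT (le_trans (step _ Nn))//.
  by rewrite ler_wpM2l// le_max lexx.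
(* Since [(1 - b)(1 + S + b) <= 1 + S], this product never increases; the bound replaces an estimate
   of the infinite product of the [1 - b n]. *)
have gsum n : (N0 <= n)%N -> g n * (1 + \sum_(N0 <= k < n) b k) <= g N0.
  elim: n => [|n IH]; first by rewrite leqn0 => /eqP N00; rewrite N00 in N01.
  rewrite leq_eqVlt => /predU1P[<-|]; first by rewrite big_geq// addr0 mulr1.
  rewrite ltnS => Nn; rewrite big_nat_recr//=; apply: le_trans (IH Nn).
  have := gstep _ Nn; have /andP[bn0 bn1] := b01 _ (leq_trans N01 Nn).
  have : 0 <= \sum_(N0 <= k < n) b k.
    by apply: sum_nat_ge0 => i Ni; apply: b_ge0; exact: leq_trans Ni.
  move: (\sum_(_ <= _ < _) _) => S S0 gn.
  have : g n.+1 * (1 + (S + b n)) <= (1 - b n) * g n * (1 + (S + b n)).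
    by rewrite ler_wpM2r//; lra.
  have : 0 <= g n * (b n * (S + b n)) by rewrite !mulr_ge0// ?addr_ge0// ltW.
  by lra.
(* The part of the sum before [N0] is added so that the sum from [N0] on still reaches
   [g N0 / e]. *)
have [N NP] := bS (\sum_(1 <= k < N0) b k + g N0 / e).
exists (maxn N0 N) => n; rewrite geq_max => /andP[Nn NNn].
have : g N0 / e <= \sum_(N0 <= k < n) b k.
  have : \sum_(1 <= k < N) b k <= \sum_(1 <= k < n) b k.
    exact: (nondecreasing_sum_nat b_ge0).
  by rewrite [in leRHS](big_cat_nat _ Nn)//=; lra.
have := gsum _ Nn; move: (\sum_(_ <= _ < n) _) => S gS.
rewrite ler_pdivrMr// => Sg.
have Gg : G n - e <= g n by rewrite le_max lexx.
suff : g n <= e by move: Gg; rewrite /e; lra.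
rewrite leNgt; apply/negP => ge.
have S0 : 0 <= S by rewrite -(pmulr_lge0 _ e0); exact: le_trans Sg.
by nra.
Qed.

End RealSequences.

(** * Convex sets and metric projections *)

Section Operators.
Context (R : realType) (H : completeNormedModType R) (dot : {dot H for idfun}).
Hypothesis hdot : norm_of_dot dot.
Implicit Types (u v w x y z p : H) (a b : R) (C : set H).

Definition nonexpansive (T : H -> H) := forall x y, `|T x - T y| <= `|x - y|.

Definition midpoint_convex C := forall u v, C u -> C v -> C (2^-1 *: (u + v)).

Definition convex_set C :=
  forall u v a, C u -> C v -> 0 <= a <= 1 -> C (u + a *: (v - u)).

Lemma convex_midpoint C : convex_set C -> midpoint_convex C.
Proof.
move=> Cc u v Cu Cv; have -> : 2^-1 *: (u + v) = u + 2^-1 *: (v - u).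
  by apply: (@dot_inj _ _ dot) => w; rewrite !dotE; field.
by apply: Cc => //; apply/andP; split; lra.
Qed.

(** For a constant family of sets, [nested_nearest] is the classical existence argument; closedness
    keeps the limit in [C]. *)
Lemma nearest_point C x : C !=set0 -> closed C -> convex_set C ->
  exists2 y, C y & forall z, C z -> `|y - x| <= `|z - x|.
Proof.
move=> [c Cc] Ccl Ccv.
have [||| y [y_ y_C y_y] ymin] := @nested_nearest _ _ _ hdot (fun=> C) x `|c - x|.
- by move=> _; exists c.
- by move=> n k _ u.
- by move=> _; exists 0%N; exact: convex_midpoint.
exists y; last by move=> z Cz; exact: ymin.
by apply: (closed_cvg _ Ccl _ y y_y); exact: nearW.
Qed.

(** If the inner product were positive, a short move from [y] towards [z] would stay in [C] and come
    closer to [x]. *)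
Lemma nearest_point_dot C x y : convex_set C -> C y ->
  (forall z, C z -> `|y - x| <= `|z - x|) ->
  forall z, C z -> dot (x - y) (z - y) <= 0.
Proof.
move=> Cc Cy ymin z Cz; rewrite leNgt; apply/negP => d0.
set d := dot _ _ in d0; set n := `|z - y| ^+ 2.
have n0 : 0 <= n by rewrite sqr_ge0.
(* The optimal step [d / n] may exceed 1 or have [n = 0]; the denominator [d + n] avoids both and
   still decreases the distance. *)
pose a := d / (d + n).
have dn : 0 < d + n by lra.
have adn : a * (d + n) = d by rewrite divfK// gt_eqF.
have a0 : 0 < a by rewrite divr_gt0.
have a1 : a <= 1 by rewrite ler_pdivrMr// mul1r lerDl.
have := ymin _ (Cc y z a Cy Cz _); rewrite (ltW a0) a1 => /(_ isT).
have -> : y + a *: (z - y) - x = a *: (z - y) - (x - y).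
  by apply: (@dot_inj _ _ dot) => w; rewrite !dotE; ring.
rewrite -ler_sqr ?nnegrE// (sqnormB hdot (_ *: _)) dotZl (dotC dot (z - y)) -/d.
by rewrite normrZ exprMn -/n (gtr0_norm a0) (distrC y); nra.
Qed.

Lemma projection C : C !=set0 -> closed C -> convex_set C ->
  exists2 P : H -> H, (forall x, C (P x)) &
    forall x z, C z -> dot (x - P x) (z - P x) <= 0.
Proof.
move=> C0 Ccl Ccv.
have [P PP] : {P : H -> H & forall x, C (P x) /\ forall z, C z -> `|P x - x| <= `|z - x|}.
  apply: (@choice _ _ (fun x y => C y /\ forall z, C z -> `|y - x| <= `|z - x|)) => x.
  by have [y] := nearest_point x C0 Ccl Ccv; exists y.
exists P => [x|x]; first exact: (PP x).1.
by apply: nearest_point_dot => //; [exact: (PP x).1|exact: (PP x).2].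
Qed.

(** Adding the two obtuse-angle inequalities at [x] and [y] shows that [P] is firmly nonexpansive;
    Cauchy-Schwarz then concludes. *)
Lemma projection_nonexpansive C (P : H -> H) : (forall x, C (P x)) ->
  (forall x z, C z -> dot (x - P x) (z - P x) <= 0) -> nonexpansive P.
Proof.
move=> PC PP x y; have h1 := PP x _ (PC y); have h2 := PP y _ (PC x).
have : `|P x - P y| ^+ 2 <= dot (x - y) (P x - P y).
  have -> : `|P x - P y| ^+ 2 = dot (x - y) (P x - P y)
      + dot (x - P x) (P y - P x) + dot (y - P y) (P x - P y).
    by rewrite -(dotxx hdot) !dotE; ring.
  by lra.
move=> /le_trans /(_ (dot_le_norm hdot _ _)); rewrite expr2.
have [->|n0] := eqVneq `|P x - P y| 0; first by rewrite normr_ge0.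
by rewrite ler_pM2r// lt_neqAle eq_sym n0 normr_ge0.
Qed.

(** * Firmly nonexpansive operators and their fixed points *)

Section FirmlyNonexpansive.
Variable T : H -> H.
Hypothesis hT : firmly_nonexpansive dot T.

Lemma firmly_nonexpansiveW : nonexpansive T.
Proof.
move=> x y; have := le_trans (hT x y) (dot_le_norm hdot _ _); rewrite expr2.
have [->|n0] := eqVneq `|T x - T y| 0; first by rewrite normr_ge0.
by rewrite ler_pM2l// lt_neqAle eq_sym n0 normr_ge0.
Qed.

Lemma firmly_quasi p y : T p = p ->
  `|T y - p| ^+ 2 <= `|y - p| ^+ 2 - `|T y - y| ^+ 2.
Proof.
move=> Tp; have := hT y p; rewrite Tp.
have -> : T y - y = (T y - p) - (y - p) by rewrite opprB addrA subrK.
by rewrite (sqnormB hdot (T y - p)); lra.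
Qed.

(** Each [y] contributes a condition affine in [z], so the fixed point set is an intersection of
    half-spaces (or the whole space), hence convex. For the converse, [y = z] gives
    [- |T z - z|^2 >= 0]. *)
Lemma firmly_Fix_halfspaces z :
  Fix T z <-> forall y, 0 <= dot (T y - z) (y - T y).
Proof.
split=> [Tz y|hz].
  have := hT y z; rewrite Tz.
  have -> : dot (T y - z) (y - T y) = dot (T y - z) (y - z) - `|T y - z| ^+ 2.
    by rewrite -(dotxx hdot) !dotE; ring.
  by lra.
apply/eqP; rewrite -subr_eq0 -normr_eq0 -sqrf_eq0 eq_le sqr_ge0 andbT.
by have := hz z; rewrite -(opprB (T z) z) dotNr dotxx//; lra.
Qed.

Lemma firmly_Fix_convex : convex_set (Fix T).
Proof.
move=> u v a /firmly_Fix_halfspaces Tu /firmly_Fix_halfspaces Tv /andP[a0 a1].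
apply/firmly_Fix_halfspaces => y; have hu := Tu y; have hv := Tv y.
rewrite (_ : T y - (u + a *: (v - u)) = (1 - a) *: (T y - u) + a *: (T y - v)).
  by rewrite dotDl !dotZl addr_ge0// mulr_ge0// subr_ge0.
by apply: (@dot_inj _ _ dot) => w; rewrite !dotE; ring.
Qed.

End FirmlyNonexpansive.

(** * Approximate fixed points of nonexpansive operators *)

Lemma nonexpansive_cvg_fix (T : H -> H) (y_ : nat -> H) y : nonexpansive T ->
  (forall n, `|T (y_ n) - y_ n| <= n.+1%:R^-1) -> y_ @ \oo --> y -> T y = y.
Proof.
move=> nT hy y_y; apply/eqP; rewrite -subr_eq0 -normr_eq0 eq_le normr_ge0 andbT.
apply/ler_addgt0Pr => eps eps0; rewrite add0r; have eps30 : 0 < eps / 3 by lra.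
move/cvgrPdist_lt : y_y => /(_ _ eps30)[N _ NP].
have [N' _ N'P] := near_infty_natSinv_lt (PosNum eps30).
set n := maxn N N'.
have h1 : `|y - y_ n| < eps / 3 := NP n (leq_maxl _ _).
have h2 : n.+1%:R^-1 < eps / 3 := N'P n (leq_maxr _ _).
have h3 := nT y (y_ n); have h4 := le_lt_trans (hy n) h2.
have h5 := ler_distD (T (y_ n)) (T y) y.
have h6 := ler_distD (y_ n) (T (y_ n)) y.
rewrite (distrC (y_ n) y) in h6.
lra.
Qed.

Lemma nonexpansive_Fix_closed (T : H -> H) : nonexpansive T -> closed (Fix T).
Proof.
move=> nT y Ty; apply/eqP; rewrite -subr_eq0 -normr_eq0 eq_le normr_ge0 andbT.
apply/ler_addgt0Pr => eps eps0; rewrite add0r; have eps20 : 0 < eps / 2 by lra.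
have [z [/= Tz]] := Ty _ (nbhsx_ballx y _ eps20).
rewrite -ball_normE/= => yz.
have := ler_distD (T z) (T y) y; have := nT y z; rewrite Tz (distrC z).
lra.
Qed.

(** With [|u - v| = 2 r], the point [T z] lies within [r + s] of both [u] and [v], so the
    parallelogram law puts it within [sqrt (2 r s + s^2)] of their midpoint [z]; and [r <= M]. *)
Lemma approx_fix_midpoint (T : H -> H) p u v (M s : R) : nonexpansive T ->
  `|u - p| <= M -> `|v - p| <= M -> `|T u - u| <= s -> `|T v - v| <= s ->
  `|T (2^-1 *: (u + v)) - 2^-1 *: (u + v)| ^+ 2 <= 2 * M * s + s ^+ 2.
Proof.
move=> nT uM vM us vs; set z := 2^-1 *: (u + v).
set r := `|u - v| / 2.
have zu : `|z - u| = r.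
  have -> : z - u = 2^-1 *: (v - u).
    by apply: (@dot_inj _ _ dot) => w; rewrite !dotE; field.
  by rewrite normrZ gtr0_norm// (distrC v) mulrC.
have zv : `|z - v| = r.
  have -> : z - v = 2^-1 *: (u - v).
    by apply: (@dot_inj _ _ dot) => w; rewrite !dotE; field.
  by rewrite normrZ gtr0_norm// mulrC.
have rM : r <= M.
  by rewrite /r; have := ler_distD p u v; rewrite (distrC p); lra.
have bnd w : `|z - w| = r -> `|T w - w| <= s -> `|w - T z| ^+ 2 <= (r + s) ^+ 2.
  move=> zw ws; rewrite ler_sqr ?nnegrE//; last first.
    by rewrite addr_ge0 ?(le_trans _ ws)// -zw.
  have := ler_distD (T w) (T z) w; have := nT z w.
  by rewrite zw (distrC w); lra.
have := bnd _ zu us; have := bnd _ zv vs; have := sqnorm_mid hdot u v (T z).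
rewrite -/z (distrC z) (_ : `|u - v| = 2 * r); last by rewrite /r; field.
have s0 : 0 <= s := le_trans (normr_ge0 _) us.
by nra.
Qed.

(** Plays the part of demiclosedness. If it failed, the sets of ever better approximate fixed points
    violating the bound would all be nonempty; [nested_nearest] extracts from them a norm convergent
    sequence, whose limit is a fixed point contradicting the hypothesis on [f]. *)
Lemma approx_fix_dot (T : H -> H) f p (M eps : R) : nonexpansive T ->
  (forall z, T z = z -> 0 <= dot f (z - p)) -> 0 < eps ->
  exists2 s, 0 < s &
    forall y, `|y - p| <= M -> `|T y - y| <= s -> - eps <= dot f (y - p).
Proof.
move=> nT hf eps0; apply: contrapT => noS.
pose K n : set H := [set y | [/\ `|y - p| <= M, `|T y - y| <= n.+1%:R^-1
  & dot f (y - p) <= - eps]].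
have K0 n : exists2 u, K n u & `|u - p| <= M.
  apply: contrapT => noK; apply: noS; exists n.+1%:R^-1; first by rewrite invr_gt0.
  move=> y yM yn; rewrite leNgt; apply/negP => fy; apply: noK.
  by exists y => //; split=> //; exact: ltW.
have M0 : 0 <= M by have [u _ uM] := K0 0%N; exact: le_trans uM.
have Kni n k : (n <= k)%N -> K k `<=` K n.
  move=> nk u [uM uk fu]; split=> //; apply: (le_trans uk).
  by rewrite lef_pV2 ?posrE// ler_nat.
have Kmid n : exists k, forall u v, K k u -> K k v -> K n (2^-1 *: (u + v)).
  set t : R := n.+1%:R^-1; have t0 : 0 < t by rewrite invr_gt0.
  have den0 : 0 < 2 * M + 1 by lra.
  (* For [s = 1 / (k + 1)], being below 1 and below [t^2 / (2 M + 1)] gives [2 M s + s^2 <= t^2], as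
     [approx_fix_midpoint] requires. *)
  have q0 : 0 < Num.min 1 (t ^+ 2 / (2 * M + 1)).
    by rewrite lt_min ltr01 divr_gt0// exprn_gt0.
  have [k _ /(_ _ (leqnn k))] := near_infty_natSinv_lt (PosNum q0).
  rewrite /= lt_min => /andP[k1]; rewrite ltr_pdivlMr// => kt.
  exists k => u v [uM uk fu] [vM vk fv].
  have e : 2^-1 *: (u + v) - p = 2^-1 *: (u - p) + 2^-1 *: (v - p).
    by apply: (@dot_inj _ _ dot) => w; rewrite !dotE; field.
  split.
  - rewrite e; apply: (le_trans (ler_normD _ _)); rewrite !normrZ gtr0_norm//.
    by move: uM vM; clear; lra.
  - rewrite -ler_sqr ?nnegrE ?(ltW t0)//.
    apply: (le_trans (approx_fix_midpoint nT uM vM uk vk)).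
    have : 0 < k.+1%:R^-1 :> R by rewrite invr_gt0.
    by rewrite -/t; move: k1 kt M0; clear; move: t (k.+1%:R^-1) => t s; nra.
  - by rewrite e dotDr !dotZr; move: fu fv; clear; lra.
have [y [y_ y_K y_y] _] := nested_nearest hdot K0 Kni Kmid.
have Ty : T y = y by apply: (nonexpansive_cvg_fix nT _ y_y) => n; have [] := y_K n.
have fy := hf _ Ty.
have f0 : 0 < `|f| + 1 by have := normr_ge0 f; lra.
have q0 : 0 < eps / (`|f| + 1) by rewrite divr_gt0.
move/cvgrPdist_lt : y_y => /(_ _ q0)[N _ /(_ _ (leqnn N))] /=.
rewrite ltr_pdivlMr// => yN.
have [_ _ fN] := y_K N.
have := dot_le_norm hdot f (y - y_ N).
have : dot f (y - y_ N) = dot f (y - p) - dot f (y_ N - p) by rewrite !dotE; ring.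
have := normr_ge0 (y - y_ N).
by nra.
Qed.

(** * Compositions of firmly nonexpansive operators *)

Section Composition.
Variable T : nat -> H -> H.
Hypothesis hT : forall i, firmly_nonexpansive dot (T i).

Fixpoint compose_upto k y := if k is k'.+1 then T k' (compose_upto k' y) else y.

Lemma compose_upto_nonexpansive k : nonexpansive (compose_upto k).
Proof.
move=> x y; elim: k => //= k; apply: le_trans; exact: firmly_nonexpansiveW.
Qed.

Lemma compose_upto_fix k p : (forall i, T i p = p) -> compose_upto k p = p.
Proof. by move=> Tp; elim: k => //= k ->. Qed.

(** Along the intermediate points the distance to [p] never increases, and it ends where it began
    because [y] is fixed by the composition. So it is constant, and [firmly_quasi] makes every
    single displacement vanish. *)
Lemma compose_upto_common_fix m p y : (forall i, T i p = p) ->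
  compose_upto m y = y -> forall i, (i < m)%N -> T i y = y.
Proof.
move=> Tp Wy.
have step k := firmly_quasi (hT k) (compose_upto k y) (Tp k).
have mono i j : (i <= j)%N ->
    `|compose_upto j y - p| ^+ 2 <= `|compose_upto i y - p| ^+ 2.
  elim: j => [|j IH]; first by rewrite leqn0 => /eqP ->.
  rewrite leq_eqVlt => /predU1P[->//|/IH]; apply: le_trans.
  by apply: (le_trans (step j)); rewrite gerBl sqr_ge0.
have stay k : (k < m)%N -> compose_upto k.+1 y = compose_upto k y.
  move=> km; apply/eqP; rewrite -subr_eq0 -normr_eq0 -sqrf_eq0 eq_le sqr_ge0 andbT.
  have /= := step k; have := mono _ _ km; have := mono _ _ (leq0n k).
  by rewrite Wy /=; lra.
have all k : (k <= m)%N -> compose_upto k y = y.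
  by elim: k => // k IH km; rewrite stay// IH// ltnW.
by move=> i im; have /= := all _ im; rewrite (all i (ltnW im)).
Qed.

(** Later operators do not amplify earlier errors, so the errors merely add up. *)
Lemma compose_upto_perturbed (phi : nat -> H) (e : nat -> H) k :
  (forall i, (i < k)%N -> phi i.+1 = T i (phi i) + e i) ->
  `|phi k - compose_upto k (phi 0%N)| <= \sum_(i < k) `|e i|.
Proof.
elim: k => [|k IH] hphi; first by rewrite subrr normr0 big_ord0.
rewrite big_ord_recr /= hphi// addrAC (le_trans (ler_normD _ _))// lerD2r.
apply: (le_trans (firmly_nonexpansiveW (hT k) _ _)); apply: IH => i ik.
by apply: hphi; exact: ltnW.
Qed.

End Composition.

(** * The descent step, the variational inequality and convergence *)

Section VariationalInequality.
Variables (F : H -> H) (eta kappa mu : R).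
Hypotheses (heta : 0 < eta) (hkappa : eta <= kappa).
Hypothesis hFmono : strongly_monotone dot eta F.
Hypothesis hFlip : kappa.-lipschitz F.
Hypothesis hmu : 0 < mu < 2 * eta / kappa ^+ 2.

(** The full step [id - mu F] shrinks squared distances by [1 - 2 tau], which is at most
    [(1 - tau)^2]; this gives a rate without square roots. *)
Let tau := mu * (2 * eta - mu * kappa ^+ 2) / 2.

Lemma descent_rate : 0 < tau <= 1.
Proof.
have /andP[mu0] := hmu; have k0 : 0 < kappa := lt_le_trans heta hkappa.
have k2 : 0 < kappa ^+ 2 by rewrite exprn_gt0.
rewrite ltr_pdivlMr// => muk; apply/andP; split.
  by rewrite /tau divr_gt0// mulr_gt0//; lra.
have ek : eta ^+ 2 <= kappa ^+ 2 by rewrite ler_sqr ?nnegrE ?(ltW heta) ?(ltW k0).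
have m2 : 0 < mu ^+ 2 by rewrite exprn_gt0.
have : mu ^+ 2 * eta ^+ 2 <= mu ^+ 2 * kappa ^+ 2 by rewrite ler_pM2l.
(* [2 mu eta - mu^2 kappa^2 <= 2 mu eta - mu^2 eta^2 <= 1], hence even [tau <= 1/2]. *)
by have := sqr_ge0 (mu * eta - 1); rewrite /tau; nra.
Qed.

(** The step of size [mu b] is the convex combination, with weight [b], of the identity and the full
    step. *)
Lemma descent_step b x y : 0 <= b <= 1 ->
  `|(x - (mu * b) *: F x) - (y - (mu * b) *: F y)| <= (1 - tau * b) * `|x - y|.
Proof.
move=> /andP[b0 b1]; have /andP[tau0 tau1] := descent_rate.
have /andP[mu0 _] := hmu.
have full : `|(x - y) - mu *: (F x - F y)| <= (1 - tau) * `|x - y|.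
  rewrite -ler_sqr ?nnegrE ?mulr_ge0 ?subr_ge0//.
  rewrite (sqnormB hdot) dotZr normrZ gtr0_norm// !exprMn (dotC dot (x - y)).
  have mono := hFmono x y.
  have /= lip := hFlip (conj I I : ([set: H] `*` [set: H]) (x, y)).
  have lip2 : `|F x - F y| ^+ 2 <= kappa ^+ 2 * `|x - y| ^+ 2.
    rewrite -exprMn ler_sqr ?nnegrE ?mulr_ge0//.
    exact/ltW/(lt_le_trans heta).
  have := sqr_ge0 (tau * `|x - y|); rewrite exprMn.
  have : mu * (eta * `|x - y| ^+ 2) <= mu * dot (F x - F y) (x - y) by rewrite ler_pM2l.
  have : mu ^+ 2 * `|F x - F y| ^+ 2 <= mu ^+ 2 * (kappa ^+ 2 * `|x - y| ^+ 2).
    by rewrite ler_pM2l// exprn_gt0.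
  have -> : (1 - tau) ^+ 2 * `|x - y| ^+ 2 = `|x - y| ^+ 2
      - (mu * (2 * eta - mu * kappa ^+ 2)) * `|x - y| ^+ 2 + tau ^+ 2 * `|x - y| ^+ 2.
    by rewrite /tau; field.
  by lra.
have -> : (x - (mu * b) *: F x) - (y - (mu * b) *: F y) =
    (1 - b) *: (x - y) + b *: ((x - y) - mu *: (F x - F y)).
  by apply: (@dot_inj _ _ dot) => w; rewrite !dotE; ring.
apply: (le_trans (ler_normD _ _)); rewrite !normrZ !ger0_norm ?subr_ge0//.
have : b * `|x - y - mu *: (F x - F y)| <= b * ((1 - tau) * `|x - y|).
  by rewrite ler_wpM2l.
by lra.
Qed.

Lemma vi_unique C p q :
  vi_solution dot F C p -> vi_solution dot F C q -> p = q.
Proof.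
move=> [Cp hp] [Cq hq]; have := hp _ Cq; have := hq _ Cp; have := hFmono p q.
rewrite -(opprB p q) dotNr dotDl dotNl => mono h1 h2.
apply/eqP; rewrite -subr_eq0 -normr_eq0 -sqrf_eq0 eq_le sqr_ge0 andbT.
by rewrite -(pmulr_rle0 _ heta); lra.
Qed.

(** Solutions arise as fixed points of the projected step [P (x - mu F x)], a contraction of rate
    [1 - tau]. *)
Lemma vi_exists C : C !=set0 -> closed C -> convex_set C ->
  exists p, vi_solution dot F C p.
Proof.
move=> C0 Ccl Ccv; have [P PC PP] := projection C0 Ccl Ccv.
have nP := projection_nonexpansive PC PP.
have /andP[tau0 tau1] := descent_rate.
have q0 : 0 <= 1 - tau by rewrite subr_ge0.
pose g x := P (x - mu *: F x).
have gT : set_fun [set: H] [set: H] g by [].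
pose G : {fun [set: H] >-> [set: H]} := HB.pack g (isFun.Build _ _ _ _ g gT).
have [||p _ pP] := @banach_fixed_point _ _ setT G _ closedT.
- exists (NngNum q0); split=> /=; first by rewrite ltrBlDr ltrDl.
  move=> [x y] _ /=; apply: (le_trans (nP _ _)).
  have := @descent_step 1 x y; rewrite !mulr1 ler01 lexx => /(_ isT).
  exact.
- by exists 0.
have {}pP : p = P (p - mu *: F p) by exact: pP.
exists p; split; first by rewrite pP.
move=> z Cz; have := PP (p - mu *: F p) _ Cz; rewrite -pP.
rewrite addrAC subrr add0r dotNl dotZl oppr_le0 pmulr_rge0//.
by have /andP[] := hmu.
Qed.

(** The convergence argument for one nonexpansive [W], with all errors of a sweep gathered in the
    single perturbation [r n]. *)
Lemma descent_cvg (W : H -> H) (p : H) (beta lambda err : nat -> R) (eps : R)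
    (x y r : nat -> H) :
  nonexpansive W -> vi_solution dot F (Fix W) p ->
  (forall n, (1 <= n)%N -> 0 < beta n <= 1) -> beta @ \oo --> (0 : R) ->
  (forall A, exists N, A <= \sum_(1 <= k < N) beta k) ->
  0 < eps -> (forall n, (1 <= n)%N -> eps <= lambda n <= 1 - eps) ->
  (forall n, (1 <= n)%N -> `|r n| <= err n) ->
  (exists B, forall N, \sum_(1 <= k < N) err k <= B) ->
  (forall n, (1 <= n)%N -> y n = x n - (mu * beta n) *: F (x n)) ->
  (forall n, (1 <= n)%N ->
     x n.+1 = (1 - lambda n) *: y n + lambda n *: (W (y n) + r n)) ->
  x @ \oo --> p.
Proof.
move=> nW [Wp hp] beta01 beta0 betaS eps0 hlambda hr [B hB] hy hx.
have /andP[tau0 tau1] := descent_rate; have /andP[mu0 _] := hmu.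
set f := F p in hp.
have c0 : 0 <= 2 * mu / tau by rewrite divr_ge0 ?(ltW tau0)// mulr_ge0// ltW.
have err0 n : (1 <= n)%N -> 0 <= err n by move=> /hr; exact: le_trans.
pose S n := \sum_(1 <= k < n) err k.
have SS n : (1 <= n)%N -> S n.+1 = S n + err n by move=> n1; rewrite /S big_nat_recr.
have Snd : {homo S : n k / (n <= k)%N >-> n <= k}. exact: nondecreasing_sum_nat.
have Scvg : cvgn S.
  by apply: nondecreasing_is_cvgn => //; exists B => _ [n _ <-]; exact: hB.
pose L := limn S.
have SL n : S n <= L by exact: nondecreasing_cvgn_le.
have S0 n : 0 <= S n.
  by have := Snd _ _ (leq0n n); rewrite {1}/S big_geq.
have y_bound n : (1 <= n)%N ->
    `|y n - p| <= (1 - tau * beta n) * `|x n - p| + mu * beta n * `|f|.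
  move=> n1; have /andP[b0 b1] := beta01 _ n1.
  have -> : y n - p = ((x n - (mu * beta n) *: F (x n)) - (p - (mu * beta n) *: f))
      - (mu * beta n) *: f.
    by rewrite hy//; apply: (@dot_inj _ _ dot) => w; rewrite !dotE; ring.
  apply: (le_trans (ler_normB _ _)); rewrite normrZ (gtr0_norm (mulr_gt0 mu0 b0)).
  by rewrite lerD2r descent_step// (ltW b0).
have y_sqbound n : (1 <= n)%N -> `|y n - p| ^+ 2 <=
    (1 - tau * beta n) * `|x n - p| ^+ 2 - 2 * (mu * beta n) * dot f (y n - p).
  move=> n1; have /andP[b0 b1] := beta01 _ n1.
  have e : y n - p = ((x n - (mu * beta n) *: F (x n)) - (p - (mu * beta n) *: f))
      + - (mu * beta n) *: f.
    by rewrite hy//; apply: (@dot_inj _ _ dot) => w; rewrite !dotE; ring.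
  rewrite {1}e; apply: (le_trans (sqnormD_le hdot _ _)); rewrite -e dotZl.
  have tb0 : 0 < tau * beta n by rewrite mulr_gt0.
  have tb1 : tau * beta n <= 1 by rewrite mulr_ile1 ?(ltW tau0) ?(ltW b0).
  have : `|(x n - (mu * beta n) *: F (x n)) - (p - (mu * beta n) *: f)| ^+ 2 <=
      ((1 - tau * beta n) * `|x n - p|) ^+ 2.
    rewrite ler_sqr ?nnegrE ?mulr_ge0 ?subr_ge0//.
    by rewrite descent_step// (ltW b0).
  have : ((1 - tau * beta n) * `|x n - p|) ^+ 2 <= (1 - tau * beta n) * `|x n - p| ^+ 2.
    by rewrite exprMn ler_wpM2r ?sqr_ge0// expr2 ler_piMl ?subr_ge0// gerBl ltW.
  by lra.
(* The error-free update, relative to [p]. *)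
pose t n := (1 - lambda n) *: (y n - p) + lambda n *: (W (y n) - p).
have Wyp n : `|W (y n) - p| <= `|y n - p| by rewrite -{1}Wp; exact: nW.
have t_bound n : (1 <= n)%N ->
    `|t n| ^+ 2 <= `|y n - p| ^+ 2 - eps ^+ 2 * `|W (y n) - y n| ^+ 2.
  move=> /hlambda /andP[l0 l1]; rewrite (sqnorm_conv hdot).
  rewrite (_ : W (y n) - p - (y n - p) = W (y n) - y n); last first.
    by rewrite opprB addrA subrK.
  have : `|W (y n) - p| ^+ 2 <= `|y n - p| ^+ 2 by rewrite ler_sqr ?nnegrE.
  have : 0 <= (lambda n * (1 - lambda n) - eps ^+ 2) * `|W (y n) - y n| ^+ 2.
    by rewrite mulr_ge0 ?sqr_ge0// subr_ge0; nra.
  have l00 : 0 <= lambda n by lra.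
  move: (`|W (y n) - p| ^+ 2) (`|y n - p| ^+ 2) (`|W (y n) - y n| ^+ 2) => a b c.
  by nra.
have t_le n : (1 <= n)%N -> `|t n| <= `|y n - p|.
  move=> n1; rewrite -ler_sqr ?nnegrE//; apply: (le_trans (t_bound _ n1)).
  by rewrite gerBl mulr_ge0 ?sqr_ge0.
have x_le n : (1 <= n)%N -> `|x n.+1 - p| <= `|t n| + err n.
  move=> n1; have /andP[l0 l1] := hlambda _ n1.
  have -> : x n.+1 - p = t n + lambda n *: r n.
    by rewrite hx// /t; apply: (@dot_inj _ _ dot) => w; rewrite !dotE; ring.
  apply: (le_trans (ler_normD _ _)); rewrite lerD2l normrZ ger0_norm; last by lra.
  apply: (le_trans _ (hr _ n1)); rewrite ler_piMl//; lra.
(* With [M0 >= mu |f| / tau], the contraction gain [tau beta M0] pays for the drift [mu beta |f|];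
   only the accumulated errors [S n] enlarge the bound. *)
pose M0 := Num.max `|x 1%N - p| (mu * `|f| / tau).
have M0f : mu * `|f| <= M0 * tau by rewrite -ler_pdivrMr// le_max lexx orbT.
pose M := M0 + L.
have step_le n : (1 <= n)%N -> `|x n - p| <= M0 + S n -> `|y n - p| <= M0 + S n.
  move=> n1 xn; apply: (le_trans (y_bound _ n1)).
  have /andP[b0 b1] := beta01 _ n1.
  have tb1 : 0 <= 1 - tau * beta n by rewrite subr_ge0 mulr_ile1 ?(ltW tau0) ?(ltW b0).
  have : (1 - tau * beta n) * `|x n - p| <= (1 - tau * beta n) * (M0 + S n).
    by rewrite ler_wpM2l.
  have : beta n * (mu * `|f|) <= beta n * (M0 * tau) by rewrite ler_pM2l.
  have : 0 <= tau * beta n * S n by exact: mulr_ge0 (mulr_ge0 (ltW tau0) (ltW b0)) (S0 n).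
  by lra.
have x_bound n : (1 <= n)%N -> `|x n - p| <= M0 + S n.
  elim: n => // -[_ _|n IH _]; first by rewrite {1}/S big_geq// addr0 le_max lexx.
  rewrite SS// addrA; apply: (le_trans (x_le n.+1 isT)); rewrite lerD2r.
  by apply: (le_trans (t_le n.+1 isT)); apply: step_le => //; exact: IH.
have y_M n : (1 <= n)%N -> `|y n - p| <= M.
  by move=> n1; apply: (le_trans (step_le _ n1 (x_bound _ n1))); rewrite lerD2l.
have M_ge0 : 0 <= M by apply: le_trans (y_M _ (leqnn 1)).
have errM n : (1 <= n)%N -> err n <= M.
  move=> n1; rewrite /M; have := SL n.+1; rewrite SS//; have := S0 n.
  have : 0 <= M0 by rewrite le_max normr_ge0.
  by lra.
(* Since [|t n|] and [err n] are at most [M], squaring [|t n| + err n] adds at most [3 M err n],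
   exactly what the tail term loses from [n] to [n.+1]. *)
pose G n := `|x n - p| ^+ 2 + 3 * M * (L - S n).
pose d n := 3 * M * (L - S n) - 2 * mu / tau * dot f (y n - p).
have Gsmall : forall e, 0 < e -> exists N, forall n, (N <= n)%N -> G n <= e.
  apply: (@recursive_inequality_small _ G (fun n => tau * beta n) d
    (fun n => eps ^+ 2 * `|W (y n) - y n| ^+ 2)
    (3 * M * L + 2 * mu / tau * (`|f| * M))).
  - move=> n n1; have /andP[b0 b1] := beta01 _ n1.
    by rewrite mulr_gt0//= mulr_ile1 ?(ltW tau0) ?(ltW b0).
  - by rewrite -(mulr0 tau); apply: cvgMr.
  - move=> A; have [N AN] := betaS (A / tau); exists N.
    by rewrite -mulr_sumr mulrC -ler_pdivrMr.
  - by move=> n _; rewrite mulr_ge0 ?sqr_ge0.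
  - move=> n n1; rewrite /d.
    have fM : - dot f (y n - p) <= `|f| * M.
      rewrite -dotNr; apply: (le_trans (dot_le_norm hdot _ _)).
      by rewrite normrN ler_wpM2l// y_M.
    have : 2 * mu / tau * - dot f (y n - p) <= 2 * mu / tau * (`|f| * M).
      by rewrite ler_wpM2l.
    have : 0 <= 3 * M * S n by rewrite !mulr_ge0.
    by lra.
  - move=> n n1; rewrite /G /d SS//.
    have xt : `|x n.+1 - p| ^+ 2 <= `|t n| ^+ 2 + 3 * M * err n.
      have : `|x n.+1 - p| ^+ 2 <= (`|t n| + err n) ^+ 2.
        by rewrite ler_sqr ?nnegrE ?addr_ge0 ?err0// x_le.
      have := le_trans (t_le _ n1) (y_M _ n1); have := errM _ n1.
      by have := err0 _ n1; nra.
    have := t_bound _ n1; have := y_sqbound _ n1.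
    have : tau * beta n * (2 * mu / tau * dot f (y n - p)) =
        2 * (mu * beta n) * dot f (y n - p) by field; rewrite gt_eqF.
    by lra.
  move=> e e0.
  (* Multiplied by [2 mu / tau], this tolerance is [e / 2]; the other half of [e] is left to the
     tail [3 M (L - S n)]. *)
  have e'0 : 0 < e * tau / (4 * mu) by apply: divr_gt0; apply: mulr_gt0.
  have [s s0 hs] := approx_fix_dot M nW hp e'0.
  exists ((eps * s) ^+ 2); first by rewrite exprn_gt0// mulr_gt0.
  have q0 : 0 < e / 2 / (3 * M + 1) by rewrite !divr_gt0//; lra.
  move/cvgrPdist_lt : Scvg => /(_ _ q0)[N _ NP].
  exists (maxn 1 N) => n; rewrite geq_max => /andP[n1 /NP /=].
  rewrite -/L ger0_norm ?subr_ge0// ltr_pdivlMr; last by lra.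
  move=> LS; rewrite -exprMn ltr_sqr ?nnegrE ?mulr_ge0 ?(ltW eps0) ?(ltW s0)//.
  rewrite ltr_pM2l// => /ltW /(hs _ (y_M _ n1)) fy; rewrite /d.
  have : 2 * mu / tau * - (e * tau / (4 * mu)) <= 2 * mu / tau * dot f (y n - p).
    by rewrite ler_wpM2l// divr_ge0 ?mulr_ge0 ?(ltW mu0) ?(ltW tau0).
  have -> : 2 * mu / tau * - (e * tau / (4 * mu)) = - (e / 2).
    by field; rewrite !gt_eqF.
  have := SL n; lra.
apply/cvgrPdist_lt => e e0.
have e2 : 0 < (e / 2) ^+ 2 by rewrite exprn_gt0// divr_gt0.
have [N NP] := Gsmall _ e2; exists N => // n /= /NP Gn.
rewrite distrC (@le_lt_trans _ _ (e / 2))//; last by lra.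
rewrite -ler_sqr ?nnegrE//; last by lra.
apply: le_trans Gn; rewrite lerDl mulr_ge0 ?mulr_ge0//.
by rewrite subr_ge0.
Qed.

End VariationalInequality.

End Operators.

(** * Assembly for the finite family *)

Theorem theorem11 (R : realType) (H : completeNormedModType R)
    (dot : {dot H for idfun}) (hdot : norm_of_dot dot)
    (m : nat) (hm : (1 <= m)%N)
    (T : 'I_m -> H -> H)
    (hT : forall i, firmly_nonexpansive dot (T i))
    (hFix : \bigcap_i Fix (T i) !=set0)
    (F : H -> H) (eta kappa : R)
    (heta : 0 < eta) (hkappa : eta <= kappa)
    (hFmono : strongly_monotone dot eta F)
    (hFlip : kappa.-lipschitz F)
    (mu : R) (hmu : 0 < mu < 2 * eta / kappa ^+ 2)
    (beta : nat -> R)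
    (hbeta : forall n, (1 <= n)%N -> 0 < beta n <= 1)
    (hbeta0 : beta @ \oo --> (0 : R))
    (hbetasum : (\sum_(1 <= n <oo) (beta n)%:E = +oo)%E)
    (eps : R) (heps : 0 < eps <= 1 / 2)
    (lambda : nat -> R)
    (hlambda : forall n, (1 <= n)%N -> eps <= lambda n <= 1 - eps)
    (e : 'I_m -> nat -> H)
    (he : forall i, (\sum_(1 <= n <oo) (`|e i n|)%:E < +oo)%E)
    (x : nat -> H) (phi : nat -> nat -> H)
    (hphi0 : forall n, (1 <= n)%N ->
       phi n 0%N = x n - (mu * beta n) *: F (x n))
    (hphiS : forall n, (1 <= n)%N -> forall i : 'I_m,
       phi n i.+1 = T i (phi n i) + e i n)
    (hx : forall n, (1 <= n)%N ->
       x n.+1 = (1 - lambda n) *: phi n 0%N + lambda n *: phi n m) :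
  exists2 xs : H,
    unique (vi_solution dot F (\bigcap_i Fix (T i))) xs
    & x @ \oo --> xs.
Proof.
(* The family is extended to all indices by the identity, which is firmly nonexpansive and fixes
   every point, and the errors are extended by 0. *)
pose Tn (i : nat) := if insub i is Some j then T j else id.
pose en n (i : nat) : H := if insub i is Some j then e j n else 0.
have TnE (i : 'I_m) : Tn i = T i by rewrite /Tn valK.
have enE n (i : 'I_m) : en n i = e i n by rewrite /en valK.
have hTn i : firmly_nonexpansive dot (Tn i).
  rewrite /Tn; case: insubP => [j _ _|_]; first exact: hT.
  by move=> u v /=; rewrite dotxx.
have [p0 hp0] := hFix.
have Tp0 i : Tn i p0 = p0.
  by rewrite /Tn; case: insubP => [j _ _|//]; exact: hp0.
pose W := compose_upto Tn m.
have nW : nonexpansive W by exact: compose_upto_nonexpansive.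
have FixW : \bigcap_i Fix (T i) = Fix W.
  apply/seteqP; split=> [z Tz|z Wz i _].
    apply: compose_upto_fix => i.
    by rewrite /Tn; case: insubP => [j _ _|//]; exact: Tz.
  by have := compose_upto_common_fix hdot hTn Tp0 Wz (ltn_ord i); rewrite TnE.
have Cconv : convex_set (\bigcap_i Fix (T i)).
  move=> u v a Cu Cv a01 i _.
  by apply: (firmly_Fix_convex hdot (hT i)) => //; [exact: Cu|exact: Cv].
have Cclosed : closed (\bigcap_i Fix (T i)).
  by rewrite FixW; exact: nonexpansive_Fix_closed.
have [p pVI] := vi_exists hdot heta hkappa hFmono hFlip hmu hFix Cclosed Cconv.
exists p; first by split=> // q; exact: (vi_unique heta hFmono pVI).
pose err n := \sum_(i < m) `|e i n|.
have /andP[eps0 _] := heps.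
have hr n : (1 <= n)%N -> `|phi n m - W (phi n 0%N)| <= err n.
  move=> n1; rewrite /err; under eq_bigr do rewrite -enE.
  apply: compose_upto_perturbed => // i im.
  by rewrite (hphiS _ n1 (Ordinal im)) -TnE -enE.
have errB : exists B, forall N, \sum_(1 <= k < N) err k <= B.
  have [B hB] : {B : 'I_m -> R &
      forall i N, \sum_(1 <= k < N) `|e i k| <= B i}.
    apply: (@choice _ _ (fun i b => forall N, \sum_(1 <= k < N) `|e i k| <= b)).
    by move=> i; apply: nneseries_bounded (he i) => n _.
  by exists (\sum_i B i) => N; rewrite exchange_big/= ler_sum.
rewrite FixW in pVI.
apply: (descent_cvg hdot heta hkappa hFmono hFlip hmu nW pVI hbeta hbeta0 _ eps0
  hlambda hr errB hphi0) => [|n n1].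
  by apply: nneseries_unbounded hbetasum => n /hbeta /andP[/ltW].
by rewrite hx// [W _ + _]addrC subrK.
Qed.
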